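(* For all integers $n\ge 0$ and $k\ge 1$, $$C_n^{(k)}=\sum_{l_1+\cdots+l_k=n}\binom{n}{l_1,\dots,l_k}C_{l_1}\cdots C_{l_k}=\sum_{l=0}^{n}\ \sum_{l_1+\cdots+l_k=l}\binom{l}{l_1,\dots,l_k}S_1(n,l)\frac{1}{(l_1+1)\cdots(l_k+1)},$$ where the sums over $l_1+\cdots+l_k$ run over $k$-tuples of nonnegative integers with the indicated sum.
   Context: $(x)_n = x(x-1)\cdots(x-n+1)$ denotes the falling factorial, with $(x)_0=1$. The Cauchy numbers of the first kind are $C_n=\int_0^1 (x)_n\,dx$, and for integers $k\ge1$, $n\ge0$ the Cauchy numbers of the first kind of order $k$ are $$C_n^{(k)}=\int_0^1\cdots\int_0^1 (x_1+\cdots+x_k)_n\,dx_1\cdots dx_k.$$ $S_1(n,l)$ are the signed Stirling numbers of the first kind, defined by $(x)_n=\sum_{l=0}^n S_1(n,l)x^l$. $\binom{n}{l_1,\dots,l_k}=\frac{n!}{l_1!\cdots l_k!}$ is the multinomial coefficient. *)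

(* Defs.v *)
From HB Require Import structures.
From mathcomp Require Import all_boot all_order all_algebra.
From mathcomp Require Import all_classical all_reals all_analysis.

Set Implicit Arguments.
Unset Strict Implicit.
Unset Printing Implicit Defensive.

Import Order.TTheory GRing.Theory Num.Theory.

Local Open Scope ring_scope.

Definition ffactr (R : nzRingType) (x : R) (n : nat) : R :=
  \prod_(i < n) (x - i%:R).

Definition stirling1 (n l : nat) : int := (ffactr ('X : {poly int}) n)`_l.

Lemma ffactr_stirling1 (R : comNzRingType) (x : R) (n : nat) :
  ffactr x n = \sum_(l < n.+1) (stirling1 n l)%:~R * x ^+ l.
Proof.
have sz : (size (ffactr ('X : {poly int}) n) <= n.+1)%N.
  have -> : ffactr ('X : {poly int}) n = \prod_(i < n) ('X - (i%:R)%:P).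
    by apply: eq_bigr => i _; rewrite polyCMn.
  by rewrite size_prod_XsubC /index_enum -enumT size_enum_ord.
have -> : ffactr x n = (map_poly intr (ffactr ('X : {poly int}) n)).[x].
  rewrite rmorph_prod horner_prod; apply: eq_bigr => i _.
  by rewrite rmorphB /= map_polyX rmorph_nat hornerD hornerN hornerX
             -polyCMn hornerC.
rewrite (@horner_coef_wide _ n.+1) ?(leq_trans (size_poly _ _)) //.
by apply: eq_bigr => l _; rewrite coef_map.
Qed.

(* The iterated integral of g(x_1, ..., x_k) over [0, 1]^k, with x_1 innermost
   and x_k outermost; each integral is the real-valued Lebesgue integral. *)
Fixpoint unit_cube_integral (R : realType) (k : nat) :
    (k.-tuple R -> R) -> R :=
  match k with
  | 0 => fun g => g [tuple]
  | k'.+1 => fun g =>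
      \int[lebesgue_measure]_(x in `[0, 1]%classic)
        unit_cube_integral (fun t : k'.-tuple R => g [tuple of rcons t x])
  end.

Definition cauchy1 (R : realType) (n : nat) : R :=
  \int[lebesgue_measure]_(x in `[0, 1]%classic) ffactr x n.

Definition cauchy1_order (R : realType) (k n : nat) : R :=
  unit_cube_integral (fun t : k.-tuple R => ffactr (\sum_(x <- t) x) n).

(* The k-tuples of nonnegative integers of sum n; the bound l_i <= n, built
   into the type, is implied by the sum condition. *)
Definition weak_compositions (k n : nat) : {set {ffun 'I_k -> 'I_n.+1}} :=
  [set l : {ffun 'I_k -> 'I_n.+1} | (\sum_(i < k) l i)%N == n].

Definition multinomial_coef (R : unitRingType) (k n : nat) (l : 'I_k -> nat) : R :=
  n`!%:R / \prod_(i < k) (l i)`!%:R.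

(* Main.v *)
Require Import Defs.
From HB Require Import structures.
From mathcomp Require Import all_boot all_order all_algebra.
From mathcomp Require Import all_classical all_reals all_analysis.

Set Implicit Arguments.
Unset Strict Implicit.
Unset Printing Implicit Defensive.

Import Order.TTheory GRing.Theory Num.Theory.
Import numFieldNormedType.Exports.

Local Open Scope ring_scope.

(** Write [p_n(x) = x (x - c) (x - 2c) ... (x - (n-1)c)]: the step [c = 1]
    gives the falling factorials, [c = 0] the powers.  For every [c] the
    exponential generating function [E_x = \sum_n p_n(x) X^n / n!] satisfies
    [E_(x + y) = E_x E_y] ([egf_step_ffact_add]).  Let [A] be the exponential
    generating function of the moments [a_n], the integrals of [p_n] over
    [0, 1].  Integrating out one variable of [E_(x_1 + ... + x_k + y)]
    therefore turns one factor [E_(x_i)] into a factor [A], so that the integral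
    of [p_n(x_1 + ... + x_k)] over the cube is [n!] times the coefficient of
    [X^n] in [A^k] ([unit_cube_integral_step_ffact]).  Expanding the power, that
    coefficient is exactly a sum of multinomial coefficients times products
    [a_(l_1) ... a_(l_k)] ([sum_weak_compositions]).

    Both formulas are this one computation.  With [c = 1] the moments are the
    Cauchy numbers, which gives the first formula.  With [c = 0] the moments
    are [1 / (n + 1)], and expanding the falling factorial of
    [x_1 + ... + x_k] in powers through the Stirling numbers gives the second.
    The induction therefore treats a linear combination of the [p_l] rather
    than a single one.

    Generating functions are truncated at a fixed degree, so that they are
    polynomials, and identities between them hold up to that degree. *)

(** * Truncated exponential generating functions *)

Definition eqmodXn (R : nzRingType) (n : nat) (p q : {poly R}) : Prop :=
  forall i, (i <= n)%N -> p`_i = q`_i.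

Lemma eqmodXnM (R : nzRingType) (n : nat) (p p' q q' : {poly R}) :
  eqmodXn n p p' -> eqmodXn n q q' -> eqmodXn n (p * q) (p' * q').
Proof.
move=> epp eqq i le_in; rewrite !coefM; apply: eq_bigr => j _.
by rewrite epp ?eqq // (leq_trans _ le_in) ?leq_subr // -ltnS ltn_ord.
Qed.

Lemma eqmodXnX (R : nzRingType) (n k : nat) (p q : {poly R}) :
  eqmodXn n p q -> eqmodXn n (p ^+ k) (q ^+ k).
Proof.
by move=> epq; elim: k => [|k IHk] //; rewrite !exprS; apply: eqmodXnM.
Qed.

Definition egf (R : fieldType) (n : nat) (a : nat -> R) : {poly R} :=
  \poly_(i < n.+1) (a i / i`!%:R).

Lemma coef_egf (R : fieldType) (n i : nat) (a : nat -> R) :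
  (i <= n)%N -> (egf n a)`_i = a i / i`!%:R.
Proof. by move=> le_in; rewrite coef_poly ltnS le_in. Qed.

Lemma eqmodXn_egf (R : fieldType) (m n : nat) (a : nat -> R) :
  (m <= n)%N -> eqmodXn m (egf m a) (egf n a).
Proof. by move=> le_mn i le_im; rewrite !coef_egf // (leq_trans le_im). Qed.

(** Expanding the [k]-th power of a sum picks one term [a_(l_i) X^(l_i) / l_i!]
    from each factor, and the coefficient of [X^m] keeps the choices of total
    degree [m].  Truncating at [m] itself makes the choice functions range over
    the very type of [weak_compositions k m]; any other truncation [n >= m]
    has the same coefficient. *)
Lemma sum_weak_compositions (R : fieldType) (k m n : nat) (a : nat -> R) :
  (m <= n)%N ->
  \sum_(l in weak_compositions k m)
      multinomial_coef R m (fun i => l i) * \prod_(i < k) a (l i) =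
    m`!%:R * (egf n a ^+ k)`_m.
Proof.
move=> le_mn; rewrite -(eqmodXnX k (eqmodXn_egf a le_mn)) //.
have -> : egf m a ^+ k = \prod_(i < k) egf m a by rewrite prodr_const card_ord.
rewrite [in RHS]/egf poly_def bigA_distr_bigA coef_sum mulr_sumr.
rewrite big_mkcond /=; apply: eq_bigr => l _.
rewrite inE scaler_prod coefZ prodrXr coefXn eq_sym.
case: eqP => _; last by rewrite !mulr0.
by rewrite mulr1 /multinomial_coef prodf_div -!mulrA [in LHS](mulrC _^-1).
Qed.

(** * Falling factorials with a step *)

Definition step_ffact (R : nzRingType) (c : R) (n : nat) (x : R) : R :=
  \prod_(i < n) (x - i%:R * c).

Lemma step_ffact1 (R : nzRingType) (n : nat) (x : R) :
  step_ffact 1 n x = ffactr x n.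
Proof. by apply: eq_bigr => i _; rewrite mulr1. Qed.

Lemma step_ffact0 (R : nzRingType) (n : nat) (x : R) :
  step_ffact 0 n x = x ^+ n.
Proof.
rewrite /step_ffact (eq_bigr (fun=> x)); last by move=> i _; rewrite mulr0 subr0.
by rewrite prodr_const card_ord.
Qed.

Lemma step_ffact_at0 (R : nzRingType) (c : R) (n : nat) :
  step_ffact c n 0 = (n == 0%N)%:R.
Proof.
case: n => [|n]; first by rewrite /step_ffact big_ord0.
by rewrite /step_ffact big_ord_recl mul0r subrr mul0r.
Qed.

Lemma step_ffact_divS (R : numFieldType) (c : R) (n : nat) (x : R) :
  n.+1%:R * (step_ffact c n.+1 x / n.+1`!%:R) =
    (x - n%:R * c) * (step_ffact c n x / n`!%:R).
Proof.
rewrite /step_ffact big_ord_recr /= factS natrM invfM.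
rewrite mulrCA [X in _ * X]mulrA divff ?pnatr_eq0 // mul1r.
by rewrite -mulrA mulrCA mulrA.
Qed.

(** Vandermonde's convolution for step [c = 1], the binomial theorem for
    [c = 0].  By [step_ffact_divS], multiplying the degree [n + 1] convolution
    by [n + 1 = i + (n + 1 - i)] lowers the degree of one factor of each term,
    at the cost of [x - i c] or [y - (n - i) c]; these add up to
    [x + y - n c], whatever [i] is. *)
Lemma step_ffact_div_add (R : numFieldType) (c : R) (n : nat) (x y : R) :
  step_ffact c n (x + y) / n`!%:R =
    \sum_(i < n.+1) (step_ffact c i x / i`!%:R)
                    * (step_ffact c (n - i) y / (n - i)`!%:R).
Proof.
set d := fun z i => step_ffact c i z / i`!%:R.
rewrite -/(d _ _).
under eq_bigr do rewrite -/(d _ _) -/(d _ _).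
elim: n => [|n IHn].
  by rewrite big_ord_recl big_ord0 /d /step_ffact !big_ord0 fact0 divr1 mulr1 addr0.
have nz : n.+1%:R != 0 :> R by rewrite pnatr_eq0.
apply: (mulfI nz); rewrite {1}/d step_ffact_divS -/(d _ _) IHn.
have -> : n.+1%:R * (\sum_(i < n.+2) d x i * d y (n.+1 - i)%N) =
   \sum_(i < n.+2) i%:R * d x i * d y (n.+1 - i)%N
   + \sum_(i < n.+2) d x i * ((n.+1 - i)%:R * d y (n.+1 - i)%N).
  rewrite mulr_sumr -big_split /=; apply: eq_bigr => i _.
  have {1}-> : n.+1%:R = i%:R + (n.+1 - i)%:R :> R.
    by rewrite -natrD subnKC // -ltnS ltn_ord.
  by rewrite mulrDl mulrA; congr (_ + _); rewrite mulrCA.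
(* The first sum starts at i = 1 and the second stops at i = n, because of
   the factors i and n + 1 - i; shifting the first aligns the two. *)
rewrite [X in _ = X + _]big_ord_recl [X in _ = _ + X]big_ord_recr /=.
rewrite subnn !mul0r mulr0 add0r addr0 -big_split mulr_sumr /=.
apply: eq_bigr => i _.
have le_in : (i <= n)%N by rewrite -ltnS ltn_ord.
rewrite /bump add1n subSS subSn // {1 3}/d !step_ffact_divS -/(d x i) -/(d y (n - i)%N).
rewrite -[X in _ = X + _]mulrA [X in _ = _ + X]mulrCA -mulrDl; congr (_ * _).
by rewrite addrACA -opprD -mulrDl -natrD subnKC.
Qed.

Lemma egf_step_ffact_add (R : numFieldType) (c : R) (n : nat) (x y : R) :
  eqmodXn n (egf n (step_ffact c ^~ (x + y)))
    (egf n (step_ffact c ^~ x) * egf n (step_ffact c ^~ y)).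
Proof.
move=> i le_in; rewrite coef_egf // step_ffact_div_add coefM.
apply: eq_bigr => j _.
by rewrite !coef_egf // (leq_trans _ le_in) ?leq_subr // -ltnS.
Qed.

Lemma egf_step_ffact_at0 (R : numFieldType) (c : R) (n : nat) :
  egf n (step_ffact c ^~ 0) = 1.
Proof.
apply/polyP => i; rewrite coef_poly coef1 step_ffact_at0.
by case: i => [|i]; rewrite ?fact0 ?divr1 // mul0r if_same.
Qed.

(** * Integrals over the unit interval and the unit cube *)

Lemma continuous_sumr (R : realType) (m : nat) (w : nat -> R)
    (f : nat -> R -> R) :
  (forall i, continuous (f i)) ->
  continuous (fun x => \sum_(i < m) w i * f i x).
Proof.
move=> cf; elim: m => [|m IHm].
  by under [X in continuous X]eq_fun do rewrite big_ord0; move=> x; apply: cvg_cst.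
under [X in continuous X]eq_fun do rewrite big_ord_recr.
move=> x; apply: cvgD; first exact: IHm.
by apply: cvgM; [apply: cvg_cst|apply: cf].
Qed.

Lemma continuous_step_ffact (R : realType) (c : R) (n : nat) :
  continuous (step_ffact c n).
Proof.
elim: n => [|n IHn].
  under [X in continuous X]eq_fun do rewrite /step_ffact big_ord0.
  by move=> x; apply: cvg_cst.
under [X in continuous X]eq_fun do rewrite /step_ffact big_ord_recr.
move=> x; apply: cvgM; first exact: IHn.
by apply: cvgB; [apply: cvg_id|apply: cvg_cst].
Qed.

Lemma Rintegral_lincomb (R : realType) (m : nat) (w : nat -> R)
    (f : nat -> R -> R) :
  (forall i, continuous (f i)) ->
  \int[lebesgue_measure]_(x in `[0, 1]%classic) (\sum_(i < m) w i * f i x) =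
    \sum_(i < m) w i * \int[lebesgue_measure]_(x in `[0, 1]%classic) f i x.
Proof.
move=> cf.
have int_cont (g : R -> R) : continuous g ->
    lebesgue_measure.-integrable `[0, 1]%classic (EFin \o g).
  move=> cg; apply: continuous_compact_integrable; first exact: segment_compact.
  exact: continuous_subspaceT.
have cwf i : continuous (fun x => w i * f i x).
  by move=> x; apply: cvgM; [apply: cvg_cst|apply: cf].
elim: m => [|m IHm].
  under eq_Rintegral do rewrite big_ord0.
  by rewrite big_ord0 Rintegral_cst //= mul0r.
under eq_Rintegral do rewrite big_ord_recr /=.
rewrite RintegralD //; last 2 first.
- by apply: int_cont; apply: continuous_sumr.
- by apply: int_cont.
by rewrite IHm big_ord_recr /= RintegralZl //; apply: int_cont.
Qed.

Lemma Rintegral_exprn (R : realType) (n : nat) :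
  \int[lebesgue_measure]_(x in `[0, 1]%classic) x ^+ n = n.+1%:R^-1 :> R.
Proof.
have nz : n.+1%:R != 0 :> R by rewrite pnatr_eq0.
rewrite /Rintegral (@continuous_FTC2 _ _ (fun x => n.+1%:R^-1 * x ^+ n.+1)) //=.
- by rewrite expr1n expr0n /= mulr0 mulr1 subr0.
- by apply: continuous_subspaceT; apply: exprn_continuous.
- have cF : continuous (fun x : R => n.+1%:R^-1 * x ^+ n.+1).
    by move=> x; apply: cvgM; [apply: cvg_cst|apply: exprn_continuous].
  split.
  + by move=> x _; apply: derivableM => //; apply: exprn_derivable.
  + by apply: cvg_at_right_filter; apply: cF.
  + by apply: cvg_at_left_filter; apply: cF.
- move=> x _; rewrite derive1E deriveZ //; last exact: exprn_derivable.
  rewrite exp_derive -[LHS]/(n.+1%:R^-1 * (n.+1%:R * x ^+ n * 1)).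
  by rewrite mulr1 mulrA mulVf // mul1r.
Qed.

Definition step_moment (R : realType) (c : R) (n : nat) : R :=
  \int[lebesgue_measure]_(x in `[0, 1]%classic) step_ffact c n x.

(** The shift [y] is what makes the induction on [k] go through: the outermost
    variable [x] of the cube is absorbed in it, so the inner integral is known
    at [x + y], and only integrals in one variable have to be proved linear. *)
Lemma unit_cube_integral_step_ffact (R : realType) (c : R) (k n : nat)
    (w : nat -> R) (y : R) :
  unit_cube_integral
      (fun t : k.-tuple R =>
         \sum_(l < n.+1) w l * step_ffact c l (\sum_(x <- t) x + y)) =
    \sum_(l < n.+1) w l * (l`!%:R
      * (egf n (step_moment c) ^+ k * egf n (step_ffact c ^~ y))`_l).
Proof.
have le_ln (l : 'I_n.+1) : (l <= n)%N by rewrite -ltnS ltn_ord.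
elim: k y => [|k IHk] y /=.
  rewrite big_nil add0r expr0 mul1r; apply: eq_bigr => l _; congr (_ * _).
  by rewrite coef_egf // mulrCA divff ?mulr1 // pnatr_eq0 -lt0n fact_gt0.
pose B := egf n (step_moment c) ^+ k * egf n (step_ffact c ^~ y).
pose b l i := l`!%:R * B`_i / (l - i)`!%:R.
pose f l x := \sum_(i < l.+1) b l i * step_ffact c (l - i) x.
have cont_f l : continuous (f l).
  apply: (continuous_sumr (f := fun i => step_ffact c (l - i))) => i.
  exact: continuous_step_ffact.
transitivity (\int[lebesgue_measure]_(x in `[0, 1]%classic)
    \sum_(l < n.+1) w l * f l x).
  apply: eq_Rintegral => x _.
  under eq_fun do under eq_bigr do rewrite big_rcons /= -addrA.
  rewrite IHk; apply: eq_bigr => l _; congr (_ * _).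
  (* The factor E_(x + y) splits, and E_y joins the factors free of x. *)
  have -> : (egf n (step_moment c) ^+ k * egf n (step_ffact c ^~ (x + y)))`_l
      = (B * egf n (step_ffact c ^~ x))`_l.
    rewrite [in RHS](mulrAC _ _ (egf _ _)) -[in RHS]mulrA.
    apply: (@eqmodXnM _ l) => // i le_il; apply: egf_step_ffact_add.
    exact: leq_trans le_il (le_ln l).
  rewrite coefM mulr_sumr; apply: eq_bigr => i _.
  rewrite coef_egf; last by rewrite (leq_trans (leq_subr _ _)).
  by rewrite /b -!mulrA [_ / _]mulrC.
rewrite (Rintegral_lincomb _ w cont_f); apply: eq_bigr => l _; congr (_ * _).
rewrite (Rintegral_lincomb _ (b l) (f := fun i => step_ffact c (l - i)));
  last by move=> i; apply: continuous_step_ffact.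
rewrite exprSr mulrAC -/B coefM mulr_sumr; apply: eq_bigr => i _.
rewrite coef_egf; last by rewrite (leq_trans (leq_subr _ _)).
by rewrite /b -!mulrA [_^-1 * _]mulrC.
Qed.

(** * Cauchy numbers of higher order *)

Theorem theorem2p2 (R : realType) (n k : nat) (hk : (1 <= k)%N) :
  cauchy1_order R k n =
    \sum_(l in weak_compositions k n)
      multinomial_coef R n (fun i => l i) * \prod_(i < k) cauchy1 R (l i)
  /\
  \sum_(l in weak_compositions k n)
      multinomial_coef R n (fun i => l i) * \prod_(i < k) cauchy1 R (l i) =
    \sum_(l < n.+1) \sum_(m in weak_compositions k l)
      multinomial_coef R l (fun i => m i) * (stirling1 n l)%:~R
        * (\prod_(i < k) ((m i).+1)%:R)^-1.
Proof.
have by_moments c (w : nat -> R) :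
    (forall x, ffactr x n = \sum_(l < n.+1) w l * step_ffact c l x) ->
    cauchy1_order R k n = \sum_(l < n.+1) w l *
      \sum_(m in weak_compositions k l)
        multinomial_coef R l (fun i => m i) * \prod_(i < k) step_moment c (m i).
  move=> ffactE; rewrite /cauchy1_order.
  under eq_fun do rewrite -[X in ffactr X]addr0 ffactE.
  rewrite unit_cube_integral_step_ffact; apply: eq_bigr => l _; congr (_ * _).
  rewrite egf_step_ffact_at0 mulr1 (sum_weak_compositions _ _ (n := n)) //.
  by rewrite -ltnS.
have cauchy1E l : step_moment 1 l = cauchy1 R l.
  by apply: eq_Rintegral => x _; rewrite step_ffact1.
have via_cauchy : cauchy1_order R k n =
    \sum_(l in weak_compositions k n)
      multinomial_coef R n (fun i => l i) * \prod_(i < k) cauchy1 R (l i).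
  rewrite (by_moments 1 (fun l => (l == n)%:R)).
    rewrite big_ord_recr /= eqxx mul1r big1 ?add0r => [|l _]; last first.
      by rewrite ltn_eqF // mul0r.
    by apply: eq_bigr => l _; under eq_bigr do rewrite cauchy1E.
  move=> x; rewrite big_ord_recr /= eqxx mul1r step_ffact1 big1 ?add0r // => l _.
  by rewrite ltn_eqF // mul0r.
split=> //; rewrite -via_cauchy (by_moments 0 (fun l => (stirling1 n l)%:~R)).
  apply: eq_bigr => l _; rewrite mulr_sumr; apply: eq_bigr => m _.
  rewrite mulrCA mulrA; congr (_ * _); rewrite -prodfV; apply: eq_bigr => i _.
  by rewrite -Rintegral_exprn; apply: eq_Rintegral => x _; rewrite step_ffact0.
move=> x; rewrite ffactr_stirling1.
by apply: eq_bigr => l _; rewrite step_ffact0.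
Qed.
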